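(* Let $S \in GL_n(\mathbb{R})$ be a Perron similarity with rows $r_1,\dots,r_n$, and suppose that $r_k = e^\top$ for some $k \in \{1,\dots,n\}$, where $e \in \mathbb{R}^n$ is the all-ones vector. Then $\mathcal{C}(S) = \mathcal{C}_r(S)$ if and only if $r_i \in \mathcal{C}(S)$ for every $i \in \{1,\dots,n\}$.
   Context: All inequalities between matrices or vectors are entrywise. A matrix $S \in GL_n(\mathbb{R})$ is called a Perron similarity if there is a real, diagonal, nonscalar matrix $D$ (i.e. $D$ is not a scalar multiple of the identity) such that $S D S^{-1} \geq 0$. For $x \in \mathbb{R}^n$, $\operatorname{diag}(x)$ denotes the diagonal matrix with diagonal entries the entries of $x$. The spectracone of $S$ is $\mathcal{C}(S) := \{x \in \mathbb{R}^n : S \operatorname{diag}(x) S^{-1} \geq 0\}$. The row cone $\mathcal{C}_r(S)$ is the convex cone generated by the rows of $S$, i.e. the set of all linear combinations of the rows of $S$ with nonnegative coefficients. Row vectors and column vectors of length $n$ are identified, so that rows of $S$ may belong to $\mathcal{C}(S)$ and the two cones can be compared as subsets of $\mathbb{R}^n$. *)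

(* Defs.v *)
From mathcomp Require Import all_boot all_order all_algebra.
From mathcomp Require Import classical_sets reals.
Set Implicit Arguments.
Unset Strict Implicit.
Unset Printing Implicit Defensive.
Import GRing.Theory Num.Theory.
Local Open Scope ring_scope.
Local Open Scope classical_set_scope.

(* [A \is a mxOver Num.nneg] says that all entries of [A] are nonnegative.
   Vectors of R^n are row vectors throughout. *)

Definition perron_similarity (R : realType) (n : nat) (S : 'M[R]_n) : Prop :=
  S \in unitmx /\
  exists D : 'M[R]_n,
    [/\ is_diag_mx D, ~~ is_scalar_mx D
      & S *m D *m invmx S \is a mxOver Num.nneg].

Definition spectracone (R : realType) (n : nat) (S : 'M[R]_n) :
    set 'rV[R]_n :=
  [set x | S *m diag_mx x *m invmx S \is a mxOver Num.nneg].

Definition row_cone (R : realType) (n : nat) (S : 'M[R]_n) : set 'rV[R]_n :=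
  [set x | exists c : 'I_n -> R,
    (forall i, 0 <= c i) /\ x = \sum_i c i *: row i S].

(* Main.v *)
(* If [M = S diag(x) S^-1 >= 0] then the k-th row of [M] is [x S^-1], because
   the k-th row of [S] is [e^T]; so [x = (x S^-1) S] is a nonnegative
   combination of the rows of [S].  Hence the spectracone always lies in the
   row cone, and the reverse inclusion holds as soon as the spectracone, being
   a convex cone, contains the generators. *)
Require Import Defs.
From mathcomp Require Import all_boot all_order all_algebra.
From mathcomp Require Import classical_sets reals.
Import GRing.Theory Num.Theory.
Local Open Scope ring_scope.
Local Open Scope classical_set_scope.

Lemma row_in_row_cone (R : realType) (n : nat) (S : 'M[R]_n) (i : 'I_n) :
  row_cone S (row i S).
Proof.
exists (fun j => (j == i)%:R); split=> [j|]; first exact: ler0n.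
rewrite (bigD1 i) //= eqxx scale1r big1 ?addr0 // => j /negbTE ->.
by rewrite scale0r.
Qed.

(** The map [x] to [S diag(x) S^-1] is linear, so each entry of the image of the sum is a
    combination, with the same coefficients [c i], of nonnegative entries. *)
Lemma spectracone_sum (R : realType) (n : nat) (S : 'M[R]_n)
    (c : 'I_n -> R) (x : 'I_n -> 'rV[R]_n) :
  (forall i, 0 <= c i) -> (forall i, spectracone S (x i)) ->
  spectracone S (\sum_i c i *: x i).
Proof.
move=> c_ge0 Sx; rewrite /spectracone /=.
rewrite linear_sum mulmx_sumr mulmx_suml; apply/mxOverP => a b.
rewrite summxE; apply: rpred_sum => i _.
rewrite linearZ /= -scalemxAr -scalemxAl mxE.
by apply: rpredM; [exact: c_ge0 | exact: (mxOverP (Sx i))].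
Qed.

Lemma spectracone_sub_row_cone (R : realType) (n : nat) (S : 'M[R]_n)
    (k : 'I_n) :
  S \in unitmx -> row k S = const_mx 1 -> spectracone S `<=` row_cone S.
Proof.
move=> S_unit Sk x /mxOverP Sx; exists (fun i => (x *m invmx S) 0 i).
have row_k : row k (S *m diag_mx x) = x.
  by rewrite row_mul Sk; apply/rowP => j; rewrite mul_mx_diag !mxE mul1r.
(* Unfolding only the first [x] through [row_k] turns the coefficient of [row i S] into the entry
   [(k, i)] of [S diag(x) S^-1]. *)
split=> [i|]; first by rewrite -{1}row_k -row_mul [X in 0 <= X]mxE; exact: Sx.
by rewrite -mulmx_sum_row mulmxKV.
Qed.

Theorem theorem3p8 (R : realType) (n : nat) (S : 'M[R]_n)
    (S_perron : perron_similarity S)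
    (S_row_e : exists k : 'I_n, row k S = const_mx 1) :
  spectracone S = row_cone S <-> forall i : 'I_n, spectracone S (row i S).
Proof.
case: S_perron => S_unit _; case: S_row_e => k Sk; split=> [-> i | Srow].
  exact: row_in_row_cone.
apply/seteqP; split; first exact: (spectracone_sub_row_cone _ _ _ k).
by move=> _ [c [c_ge0 ->]]; apply: spectracone_sum.
Qed.
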